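(* Let $X$ be an infinite-dimensional closed sublattice of $C[0,1]$. Then either $X$ is lattice isomorphic to $c_0$, or $X$ contains a closed sublattice which is lattice isomorphic to $C[0,1]$.
   Context: Banach lattices are real. $C[0,1]$ is the Banach lattice of continuous real-valued functions on $[0,1]$ with the supremum norm and pointwise order, and $c_0$ is the Banach lattice of real null sequences with the supremum norm and coordinatewise order. A sublattice is a linear subspace closed under the lattice operations $\vee,\wedge$. An operator is a bounded linear map; an operator $T\colon X\to Y$ between Banach lattices is a lattice homomorphism if $T(x\vee y)=Tx\vee Ty$ and $T(x\wedge y)=Tx\wedge Ty$ for all $x,y\in X$. Two Banach lattices are lattice isomorphic if there is a lattice homomorphism from one onto the other which is also an isomorphism of Banach spaces (not necessarily isometric). *)

(* Defs.v *)
From HB Require Import structures.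
From mathcomp Require Import all_boot all_order all_algebra.
From mathcomp Require Import all_classical all_reals all_analysis.
From mathcomp Require Import lra.
Set Implicit Arguments.
Unset Strict Implicit.
Unset Printing Implicit Defensive.
Import Order.TTheory GRing.Theory Num.Theory.
Import numFieldNormedType.Exports.
Local Open Scope classical_set_scope.
Local Open Scope ring_scope.

(* In [bl_norm] the lattice absolute value of [x] is the join of [x] and [- x];
   it must not be confused with the norm [`|x|]. *)
HB.mixin Record isBanachLattice (R : realType) E
    & CompleteNormedModule R E := {
  bl_le : E -> E -> Prop ;
  bl_join : E -> E -> E ;
  bl_meet : E -> E -> E ;
  bl_le_refl : forall x, bl_le x x ;
  bl_le_anti : forall x y, bl_le x y -> bl_le y x -> x = y ;
  bl_le_trans : forall x y z, bl_le x y -> bl_le y z -> bl_le x z ;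
  bl_joinP : forall x y z, bl_le (bl_join x y) z <-> bl_le x z /\ bl_le y z ;
  bl_meetP : forall x y z, bl_le x (bl_meet y z) <-> bl_le x y /\ bl_le x z ;
  bl_leD : forall x y z, bl_le x y -> bl_le (x + z) (y + z) ;
  bl_leZ : forall (a : R) x, 0 <= a -> bl_le 0 x -> bl_le 0 (a *: x) ;
  bl_norm : forall x y,
    bl_le (bl_join x (- x)) (bl_join y (- y)) -> `|x| <= `|y| }.

#[short(type="banachLatticeType")]
HB.structure Definition BanachLattice (R : realType) :=
  {E of CompleteNormedModule R E & isBanachLattice R E}.

Section banach_lattice_notions.
Variable R : realType.
Implicit Types E F : banachLatticeType R.

Definition linear_subspace E (A : set E) :=
  A 0 /\ (forall (a : R) (x y : E), A x -> A y -> A (a *: x + y)).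

Definition sublattice E (A : set E) :=
  [/\ linear_subspace A,
      forall x y, A x -> A y -> A (bl_join x y) &
      forall x y, A x -> A y -> A (bl_meet x y)].

Definition closed_sublattice E (A : set E) := sublattice A /\ closed A.

Definition finite_dimensional E (A : set E) :=
  exists (n : nat) (e : 'I_n -> E), (forall i, A (e i)) /\
    (forall x, A x -> exists c : 'I_n -> R, x = \sum_i c i *: e i).

Definition infinite_dimensional E (A : set E) := ~ finite_dimensional A.

(* Sublattices are Banach lattices in their own right: a map defined on a
   sublattice [A] of [E] is represented by a function on [E] whose values
   outside [A] are irrelevant. *)
Definition operator_on E F (A : set E) (T : E -> F) :=
  (forall (a : R) (x y : E), A x -> A y -> T (a *: x + y) = a *: T x + T y) /\
  (exists M : R, forall x, A x -> `|T x| <= M * `|x|).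

Definition lattice_homomorphism_on E F (A : set E) (T : E -> F) :=
  [/\ operator_on A T,
      forall x y, A x -> A y -> T (bl_join x y) = bl_join (T x) (T y) &
      forall x y, A x -> A y -> T (bl_meet x y) = bl_meet (T x) (T y)].

(* The last clause is the boundedness of the inverse of [T]. *)
Definition banach_isomorphism_on E F (A : set E) (B : set F) (T : E -> F) :=
  [/\ operator_on A T, set_bij A B T &
      exists M : R, forall x, A x -> `|x| <= M * `|T x|].

Definition lattice_isomorphic E F (A : set E) (B : set F) :=
  exists T : E -> F, lattice_homomorphism_on A T /\ banach_isomorphism_on A B T.

End banach_lattice_notions.

(* A vector lattice of bounded functions closed under uniform limits; it is a
   Banach lattice for the supremum norm and the pointwise order. *)
Record supSpace (R : realType) (T : Type) := SupSpace {
  supCarrier : set (T -> R) ;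
  supCarrier0 : supCarrier (fun=> 0) ;
  supCarrierL : forall (a : R) f g, supCarrier f -> supCarrier g ->
    supCarrier (fun t => a * f t + g t) ;
  supCarrierU : forall f g, supCarrier f -> supCarrier g ->
    supCarrier (fun t => Num.max (f t) (g t)) ;
  supCarrierI : forall f g, supCarrier f -> supCarrier g ->
    supCarrier (fun t => Num.min (f t) (g t)) ;
  supCarrier_bounded : forall f, supCarrier f ->
    exists M : R, forall t, `|f t| <= M ;
  supCarrier_lim : forall f,
    (forall e : R, 0 < e ->
      exists2 g, supCarrier g & forall t, `|f t - g t| <= e) ->
    supCarrier f }.

Section sup_space.
Variables (R : realType) (T : Type) (S : supSpace R T).

Definition supPred : {pred T -> R} := mem (supCarrier S).

Definition supFun : Type := {f : T -> R | f \in supPred}.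
HB.instance Definition _ := SubChoice.on supFun.

Implicit Types f g h : supFun.

Lemma supPredP (f : T -> R) : (f \in supPred) = `[< supCarrier S f >].
Proof. by apply/idP/asboolP => [/set_mem|/mem_set]. Qed.

Lemma supFunP f : supCarrier S (val f).
Proof. by have := valP f; rewrite supPredP => /asboolP. Qed.

Definition mkSup (f : T -> R) (Sf : supCarrier S f) : supFun :=
  exist _ f (mem_set Sf : f \in supPred).

Lemma supFun_eq f g : (forall t, val f t = val g t) -> f = g.
Proof. by move=> fg; apply: val_inj; apply: funext. Qed.

Lemma supPred_submod : submod_closed supPred.
Proof.
split; first by rewrite supPredP; apply/asboolP; exact: supCarrier0.
move=> a f g; rewrite !supPredP => /asboolP Sf /asboolP Sg; apply/asboolP.
exact: supCarrierL.
Qed.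
HB.instance Definition _ :=
  GRing.isSubmodClosed.Build R (T -> R) supPred supPred_submod.
HB.instance Definition _ := [SubChoice_isSubLmodule of supFun by <:].

Definition supNorm f : R := sup [set `|val f t| | t in [set: T]].

Lemma supNorm_ub f t : `|val f t| <= supNorm f.
Proof.
have [M fM] := supCarrier_bounded (supFunP f).
apply: ub_le_sup; last by exists t.
by exists M => _ [s _ <-].
Qed.

Lemma supNorm_ge0 f : 0 <= supNorm f.
Proof.
rewrite /supNorm; have [->|/set0P [_ [t _ _]]] :=
  eqVneq [set `|val f t| | t in [set: T]] set0; first by rewrite sup0.
exact: le_trans (normr_ge0 _) (supNorm_ub f t).
Qed.

Lemma supNorm_leP f M : 0 <= M ->
  (supNorm f <= M) <-> (forall t, `|val f t| <= M).
Proof.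
move=> M0; split=> [fM t|fM]; first exact: le_trans (supNorm_ub f t) fM.
rewrite /supNorm; have [->|/set0P ne] :=
  eqVneq [set `|val f t| | t in [set: T]] set0; first by rewrite sup0.
by apply: ge_sup => // _ [t _ <-].
Qed.

Lemma supNormD f g : supNorm (f + g) <= supNorm f + supNorm g.
Proof.
apply/supNorm_leP => [|t]; first by rewrite addr_ge0 ?supNorm_ge0.
by rewrite (le_trans (ler_normD _ _))// lerD// supNorm_ub.
Qed.

Lemma supNormZ (a : R) f : supNorm (a *: f) = `|a| * supNorm f.
Proof.
have le1 (b : R) h : supNorm (b *: h) <= `|b| * supNorm h.
  apply/supNorm_leP => [|t]; first by rewrite mulr_ge0 ?supNorm_ge0.
  by rewrite [val _ _](_ : _ = b * val h t)// normrM ler_wpM2l// supNorm_ub.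
apply/eqP; rewrite eq_le le1/=.
have [->|a0] := eqVneq a 0; first by rewrite normr0 mul0r supNorm_ge0.
have := le1 a^-1 (a *: f); rewrite scalerA mulVf// scale1r normfV.
by rewrite ler_pdivlMl ?normr_gt0.
Qed.

Lemma supNorm_eq0 f : supNorm f = 0 -> f = 0.
Proof.
move=> f0; apply: supFun_eq => t; apply/eqP.
by rewrite -[val 0 t]/0 -normr_le0 -f0 supNorm_ub.
Qed.

HB.instance Definition _ :=
  Lmodule_isNormed.Build R supFun supNormD supNormZ supNorm_eq0.

Lemma supFun_normE f : `|f| = sup [set `|val f t| | t in [set: T]].
Proof. by []. Qed.

Lemma supFun_complete (F : set_system supFun) :
  ProperFilter F -> cauchy F -> cvg F.
Proof.
move=> FF Fc.
have Fe (e : R) : 0 < e -> exists2 f, F (ball f e) & True.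
  by move=> e0; have [f Ff] := (cauchyP F).1 Fc e e0; exists f.
have cvgt t : cvg ((fun f => val f t) @ F).
  apply: cauchy_cvg; apply: cauchy_exP => e e0.
  have [f Ff _] := Fe e e0; exists (val f t).
  change (F [set g | ball (val f t) e (val g t)]).
  apply: filterS Ff => g; rewrite -!ball_normE /= => fg.
  exact: le_lt_trans (supNorm_ub (f - g) t) fg.
pose l t := lim ((fun f => val f t) @ F).
have near_l (e : R) : 0 < e ->
    exists f, F (ball f e) /\ forall t, `|l t - val f t| <= e.
  move=> e0; have [f Ff _] := Fe e e0; exists f; split=> // t.
  have cB : closed (closed_ball_ Num.norm (val f t) e).
    exact: closed_closed_ball_.
  rewrite distrC; suff: closed_ball_ Num.norm (val f t) e (l t) by [].
  refine (@closed_cvg _ _ F _ (fun h : supFun => val h t) _ cB _ _ (cvgt t)).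
  apply: filterS Ff => g; rewrite -ball_normE /= => /ltW fg.
  exact: le_trans (supNorm_ub (f - g) t) fg.
have Sl : supCarrier S l.
  apply: supCarrier_lim => e /near_l [f [_ lf]].
  by exists (val f) => //; exact: supFunP.
apply/cvg_ex; exists (mkSup Sl); apply/cvg_ballP => e e0.
have [|f [Ff lf]] := near_l (e / 3); first by rewrite divr_gt0.
apply: filterS Ff => g; rewrite -!ball_normE /= => fg.
rewrite -(subrK f (mkSup Sl)) -addrA.
apply: le_lt_trans (ler_normD _ _) _.
have : `|mkSup Sl - f| <= e / 3.
  by apply/supNorm_leP; [rewrite divr_ge0// ltW | exact: lf].
move=> /lerD /(_ (ltW fg)) /le_lt_trans; apply.
by rewrite -mulrDl -mulr2n -[ltRHS]mulr1 -(mulr_natr e) -mulrA ltr_pM2l//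
  ltr_pdivrMr// mul1r ltr_nat.
Qed.

HB.instance Definition _ := Uniform_isComplete.Build supFun supFun_complete.

Definition supLe f g : Prop := forall t, val f t <= val g t.

Definition supJoin f g := mkSup (supCarrierU (supFunP f) (supFunP g)).
Definition supMeet f g := mkSup (supCarrierI (supFunP f) (supFunP g)).

Lemma supLe_refl f : supLe f f.
Proof. by move=> t. Qed.

Lemma supLe_anti f g : supLe f g -> supLe g f -> f = g.
Proof. by move=> fg gf; apply: supFun_eq => t; apply/eqP; rewrite eq_le fg gf. Qed.

Lemma supLe_trans f g h : supLe f g -> supLe g h -> supLe f h.
Proof. by move=> fg gh t; exact: le_trans (fg t) (gh t). Qed.

Lemma supJoinP f g h : supLe (supJoin f g) h <-> supLe f h /\ supLe g h.
Proof.
split=> [fgh|[fh gh] t]; last by rewrite /= ge_max fh gh.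
by split=> t; have := fgh t; rewrite /= ge_max => /andP[].
Qed.

Lemma supMeetP f g h : supLe f (supMeet g h) <-> supLe f g /\ supLe f h.
Proof.
split=> [fgh|[fh gh] t]; last by rewrite /= le_min fh gh.
by split=> t; have := fgh t; rewrite /= le_min => /andP[].
Qed.

Lemma supLeD f g h : supLe f g -> supLe (f + h) (g + h).
Proof. by move=> fg t; exact: (lerD (fg t) (lexx (val h t))). Qed.

Lemma supLeZ (a : R) f : 0 <= a -> supLe 0 f -> supLe 0 (a *: f).
Proof. by move=> a0 f0 t; exact: (mulr_ge0 a0 (f0 t)). Qed.

Lemma supLe_norm f g :
  supLe (supJoin f (- f)) (supJoin g (- g)) -> `|f| <= `|g|.
Proof.
move=> fg; apply/supNorm_leP => [|t]; first exact: supNorm_ge0.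
apply: le_trans (supNorm_ub g t).
have : Num.max (val f t) (- val f t) <= Num.max (val g t) (- val g t) := fg t.
by rewrite !maxrN.
Qed.

HB.instance Definition _ := isBanachLattice.Build R supFun
  supLe_refl supLe_anti supLe_trans supJoinP supMeetP supLeD supLeZ supLe_norm.

End sup_space.

Section concrete_spaces.
Variable R : realType.

(* Coerced to a type, [unit_interval] carries the topology induced by [R]. *)
Definition unit_interval : set R := `[0%R, 1%R].

#[global] Instance unit_interval_filter (t : unit_interval) :
  ProperFilter (nbhs t).
Proof. exact: (@nbhs_pfilter (set_type unit_interval) t). Qed.

Definition continuous01 : set (unit_interval -> R) := [set f | continuous f].

Lemma continuous01_0 : continuous01 (fun=> 0).
Proof. by move=> t; exact: cvg_cst. Qed.

Lemma continuous01L (a : R) f g : continuous01 f -> continuous01 g ->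
  continuous01 (fun t => a * f t + g t).
Proof.
move=> cf cg t; apply: cvgD; last exact: cg.
by apply: cvgM; [exact: cvg_cst|exact: cf].
Qed.

Lemma continuous01U f g : continuous01 f -> continuous01 g ->
  continuous01 (fun t => Num.max (f t) (g t)).
Proof. by move=> cf cg t; apply: continuous_max; [exact: cf|exact: cg]. Qed.

Lemma continuous01I f g : continuous01 f -> continuous01 g ->
  continuous01 (fun t => Num.min (f t) (g t)).
Proof. by move=> cf cg t; apply: continuous_min; [exact: cf|exact: cg]. Qed.

Lemma continuous01_bounded f : continuous01 f ->
  exists M : R, forall t, `|f t| <= M.
Proof.
move=> /(subspace_valL_continuousP' _ 0) cf.
have /compact_bounded : compact (valL_ 0 f @` unit_interval).
  by apply: continuous_compact => //; exact: segment_compact.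
move=> [M [_ fM]]; exists (M + 1) => t.
apply: (fM (M + 1)); first by rewrite ltrDl.
exists (val t) => /=.
  by have := valP t => /set_mem.
by have /funeqP /(_ t) := @valLK _ _ 0 unit_interval f.
Qed.

Lemma continuous01_lim f :
  (forall e : R, 0 < e ->
    exists2 g, continuous01 g & forall t, `|f t - g t| <= e) ->
  continuous01 f.
Proof.
move=> fg t; apply/cvgrPdist_le => e e0.
have e3 : 0 < e / 3 by rewrite divr_gt0.
have [g cg fge] := fg _ e3.
have /cvgrPdist_le /(_ _ e3) := cg t.
apply: filterS => s gts; have fs := fge s; have ft := fge t.
have -> : f t - f s = (f t - g t) + (g t - g s) - (f s - g s) by lra.
rewrite (le_trans (ler_normB _ _))//.
have := ler_normD (f t - g t) (g t - g s).
lra.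
Qed.

Definition C01_supSpace : supSpace R unit_interval :=
  SupSpace continuous01_0 continuous01L continuous01U continuous01I
    continuous01_bounded continuous01_lim.

Definition C01 : banachLatticeType R := supFun C01_supSpace.

Definition null_seq : set (nat -> R) := [set u | u @ \oo --> (0 : R)].

Lemma null_seq0 : null_seq (fun=> 0).
Proof. exact: cvg_cst. Qed.

Lemma null_seqL (a : R) u v : null_seq u -> null_seq v ->
  null_seq (fun n => a * u n + v n).
Proof.
move=> cu cv; rewrite /null_seq /= -[X in _ --> X](addr0 (0 : R)).
rewrite -[X in X + _](mulr0 a); apply: cvgD => //.
by apply: cvgM => //; exact: cvg_cst.
Qed.

Lemma null_seqP u :
  null_seq u <-> forall e : R, 0 < e -> \forall n \near \oo, `|u n| <= e.
Proof.
split=> [/cvgr0Pnorm_le|u0]; first by [].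
exact/cvgr0Pnorm_le.
Qed.

Lemma null_seqU u v : null_seq u -> null_seq v ->
  null_seq (fun n => Num.max (u n) (v n)).
Proof.
move=> /null_seqP u0 /null_seqP v0; apply/null_seqP => e e0.
by apply: filterS2 (u0 e e0) (v0 e e0) => n; rewrite /Num.max; case: ifP.
Qed.

Lemma null_seqI u v : null_seq u -> null_seq v ->
  null_seq (fun n => Num.min (u n) (v n)).
Proof.
move=> /null_seqP u0 /null_seqP v0; apply/null_seqP => e e0.
by apply: filterS2 (u0 e e0) (v0 e e0) => n; rewrite /Num.min; case: ifP.
Qed.

Lemma null_seq_bounded u : null_seq u -> exists M : R, forall n, `|u n| <= M.
Proof.
move=> u0; have /cvg_seq_bounded [M [_ uM]] : cvgn (u : nat -> R^o).
  by apply/cvg_ex; exists 0.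
by exists (M + 1) => n; apply: (uM (M + 1)) => //; rewrite ltrDl.
Qed.

Lemma null_seq_lim u :
  (forall e : R, 0 < e ->
    exists2 v, null_seq v & forall n, `|u n - v n| <= e) ->
  null_seq u.
Proof.
move=> uv; apply/null_seqP => e e0.
have e2 : 0 < e / 2 by rewrite divr_gt0.
have [v /null_seqP /(_ _ e2) v0 uve] := uv _ e2.
apply: filterS v0 => n vn; have un := uve n.
by rewrite -(subrK (v n) (u n)) (le_trans (ler_normD _ _))//; lra.
Qed.

Definition c0_supSpace : supSpace R nat :=
  SupSpace null_seq0 null_seqL null_seqU null_seqI null_seq_bounded
    null_seq_lim.

Definition c0 : banachLatticeType R := supFun c0_supSpace.

End concrete_spaces.

(* Main.v *)
Require Import Defs.
From mathcomp Require Import all_boot all_order all_algebra.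
From mathcomp Require Import all_classical all_reals all_analysis.
From mathcomp Require Import lra ring.
Set Implicit Arguments.
Unset Strict Implicit.
Unset Printing Implicit Defensive.
Import Order.TTheory GRing.Theory Num.Theory.
Import numFieldNormedType.Exports.
Local Open Scope classical_set_scope.
Local Open Scope ring_scope.

(* Let [X] be a closed sublattice of C[0,1].  If some [f >= 0] and [g] in [X]
   have a nonconstant ratio [g / f] on an interval where [f > 0], then after
   replacing [g] by a combination of [f] and [g] the ratio covers [0,1] on that
   interval, and [phi |-> f * phi (g / f)], with [g / f] truncated to [0,1],
   embeds C[0,1] into [X]; its values lie in [X] because continuous functions
   on [0,1] are uniform limits of lattice polynomials in [1] and the identity.
   Otherwise evaluations at nearby points where [X] does not vanish are
   proportional on [X].  The classes of points with proportional evaluations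
   are then open, hence countably many, and each class [C] carries an atom of
   [X], unique up to scaling.  Normalizing the atoms and evaluating at points
   where they peak identifies [X] isometrically with c_0 on the set of classes:
   by compactness [|f| >= e] is covered by finitely many classes, and [f]
   vanishes outside all of them. *)

(** * Compactness and the topology of the unit interval *)

Lemma compact_ind (T : topologicalType) (K : set T) (P : set T -> Prop) :
  compact K -> P set0 -> (forall A B, A `<=` B -> P B -> P A) ->
  (forall A B, P A -> P B -> P (A `|` B)) ->
  (forall x, K x -> exists2 N, nbhs x N & P N) -> P K.
Proof.
move=> Kc P0 Psub PU Ploc; apply: contrapT => nPK.
(* If [P K] fails, the sets whose complement in [K] satisfies [P] form a proper filter containing
   [K]. At a cluster point [x] in [K], the filter contains the complement of the neighbourhood [N]
   given by [Ploc], a contradiction. *)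
pose F : set_system T := fun A => P (K `\` A).
have FF : ProperFilter F.
  split; first by rewrite /F setD0.
  split.
  - by rewrite /F setDT.
  - by move=> A B FA FB; rewrite /F setDIr; exact: PU.
  - by move=> A B AB; apply: Psub => x [Kx nBx]; split=> // /AB.
have [|x [Kx clx]] := Kc F FF; first by rewrite /F setDv.
have [N xN PN] := Ploc x Kx.
have FN : F (~` N) by apply: Psub PN => y [_ /contrapT].
by have [y []] := clx _ _ FN xN.
Qed.

Section unit_interval_topology.
Variable R : realType.
Local Notation I := (@unit_interval R).
Implicit Types (s t : I) (x y : R).

Lemma clip_subproof x : Num.max 0 (Num.min x 1) \in I.
Proof.
by apply/mem_set; rewrite /unit_interval/= in_itv/= le_max lexx/= ge_max ler01 ge_min lexx orbT.
Qed.
(** Retraction of the line onto [0,1]. Composing with it turns a function on the subtype into one on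
    [R], where the extreme and intermediate value theorems apply. *)
Definition clip x : I := exist (fun z => z \in I) _ (clip_subproof x).

Lemma val_unit t : 0 <= val t <= 1.
Proof. by have := set_mem (valP t); rewrite /unit_interval/= in_itv. Qed.

Lemma val_clip x : 0 <= x <= 1 -> val (clip x) = x.
Proof. by case/andP=> x0 x1; rewrite /= (min_idPl x1) (max_idPr x0). Qed.

Lemma clipK t : clip (val t) = t.
Proof. by apply: val_inj; rewrite val_clip// val_unit. Qed.

Lemma clip_dist x y : `|val (clip x) - val (clip y)| <= `|x - y|.
Proof.
rewrite /= /Num.max /Num.min.
by case: (ltP x 1); case: (ltP y 1) => ? ?; repeat (case: ifPn => ?);
  rewrite ?normr_le0; do ?[rewrite -?leNgt in * |-]; rewrite ler_norml;
  have := ler_norm (x - y); have := ler_norm (y - x); rewrite (distrC y x); lra.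
Qed.

Lemma near_unitP t (P : set I) :
  (\forall s \near t, P s) <->
  exists2 e : R, 0 < e & forall s, `|val t - val s| < e -> P s.
Proof.
split.
  by move=> /nbhs_ballP [e e0 eP]; exists e => // s ts; apply: eP.
by move=> [e e0 eP]; apply/nbhs_ballP; exists e => // s ts; apply: eP.
Qed.

Lemma continuous_clip : continuous clip.
Proof.
move=> x A /near_unitP [e e0 eA].
apply/nbhs_ballP; exists e => // y xy; apply: eA.
exact: le_lt_trans (clip_dist x y) xy.
Qed.

Lemma compact_unit : compact [set: I].
Proof.
have -> : [set: I] = clip @` `[0, 1].
  apply/seteqP; split=> // t _; exists (val t); last exact: clipK.
  by rewrite /= in_itv; exact: val_unit.
apply: continuous_compact; last exact: segment_compact.
by apply: continuous_subspaceT; exact: continuous_clip.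
Qed.

(** Compactness leaves finitely many local choices, and their minimum keeps every bound because [B]
    is downward closed. This serves both the lattice approximation theorem and the construction of
    atoms. *)
Lemma near_meet (L : set (I -> R)) (B : I -> set R) :
  (exists f, L f) ->
  (forall f g, L f -> L g -> L (fun t => Num.min (f t) (g t))) ->
  (forall t x y, x <= y -> B t y -> B t x) ->
  (forall t, exists2 f, L f & \forall s \near t, B s (f s)) ->
  exists2 f, L f & forall t, B t (f t).
Proof.
move=> [f0 Lf0] Lmin Bdown Bloc.
pose P A := exists2 f, L f & forall t, A t -> B t (f t).
suff [f Lf fB] : P setT by exists f => // t; exact: fB.
apply: (compact_ind compact_unit).
- by exists f0.
- by move=> A C AC [f Lf fB]; exists f => // t /AC; exact: fB.
- move=> A C [f Lf fB] [g Lg gB]; exists (fun t => Num.min (f t) (g t)).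
    exact: Lmin.
  move=> t [/fB|/gB]; apply: Bdown; first by rewrite ge_min lexx.
  by rewrite ge_min lexx orbT.
- move=> t _; have [f Lf fB] := Bloc t; exists [set s | B s (f s)] => //.
  by exists f.
Qed.

End unit_interval_topology.

(** * The lattice form of the Stone-Weierstrass theorem *)

Section stone.
Variable R : realType.
Local Notation I := (@unit_interval R).

Lemma continuous_affine (a b : R) : continuous01 (fun s : I => a * val s + b).
Proof.
apply: continuous01L => [|t]; last exact: cvg_cst.
exact: initial_continuous.
Qed.

Lemma continuous01_near (f g : I -> R) (t : I) :
  continuous01 f -> continuous01 g -> f t < g t -> \forall s \near t, f s < g s.
Proof.
move=> cf cg fg; have cgf : continuous01 (fun s => (-1) * f s + g s).
  exact: continuous01L.
have : 0 < (-1) * f t + g t by lra.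
move=> /(cvgr_gt _ (cgf t)); apply: filterS => s; lra.
Qed.

Lemma stone_lattice (A : set (I -> R)) (phi : I -> R) (e : R) :
  A `<=` @continuous01 R ->
  (forall a b : R, A (fun s => a * val s + b)) ->
  (forall f g, A f -> A g -> A (fun t => Num.max (f t) (g t))) ->
  (forall f g, A f -> A g -> A (fun t => Num.min (f t) (g t))) ->
  continuous01 phi -> 0 < e ->
  exists2 psi, A psi & forall s, `|phi s - psi s| <= e.
Proof.
move=> Ac Aaff Amax Amin cphi e0.
have cphie d : continuous01 (fun s => phi s + d).
  suff -> : (fun s => phi s + d) = (fun s => 1 * phi s + d).
    by apply: continuous01L => // t; exact: cvg_cst.
  by apply: funext => s; rewrite mul1r.
(* For each [t], an affine function interpolates [phi] at [r] and [t], so it stays below [phi + e]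
   near [t]; minima do not change the common value at [r]. *)
have below r : exists2 h, A h & h r = phi r /\ forall s, h s <= phi s + e.
  have [||||h [Ah hr] hphi] := @near_meet R
    [set h | A h /\ h r = phi r] (fun s => [set x | x <= phi s + e]).
  - exists (fun s => 0 * val s + phi r); split; first exact: Aaff.
    by rewrite mul0r add0r.
  - move=> f g [Af fr] [Ag gr]; split; first exact: Amin.
    by rewrite fr gr minxx.
  - by move=> t x y; exact: le_trans.
  - move=> t; suff [a [b [ab1 ab2]]] : exists a b : R,
        a * val r + b = phi r /\ a * val t + b = phi t.
      exists (fun s => a * val s + b); first by split => //; exact: Aaff.
      have abt : a * val t + b < phi t + e by rewrite ab2 ltrDl.
      have := continuous01_near (@continuous_affine a b) (cphie e) abt.
      by apply: filterS => s /ltW.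
    have [->|rt] := eqVneq r t.
      by exists 0, (phi t); rewrite mul0r add0r.
    have d0 : val r - val t != 0 by rewrite subr_eq0.
    exists ((phi r - phi t) / (val r - val t)).
    exists (phi r - (phi r - phi t) / (val r - val t) * val r).
    by split; field.
  - by exists h.
(* Second pass, applied to negatives: minima of the functions [h] are maxima of the members [- h] of
   [A]. *)
have [||||h [Ah hphi] phih] := @near_meet R
    [set h | A (fun t => - h t) /\ forall s, - h s <= phi s + e]
    (fun s => [set x | phi s - e <= - x]).
- have [h Ah [_ hphi]] := below (clip 0).
  exists (fun s => - h s); split.
    by have -> : (fun t => - - h t) = h by apply: funext => s; rewrite opprK.
  by move=> s; rewrite opprK.
- move=> f g [Af fphi] [Ag gphi]; split.
    have := Amax _ _ Af Ag; congr A; apply: funext => t.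
    by rewrite oppr_min.
  by move=> s; rewrite oppr_min ge_max fphi gphi.
- by move=> t x y xy /= /le_trans; apply; rewrite lerN2.
- move=> r; have [h Ah [hr hphi]] := below r; exists (fun s => - h s).
    split; last by move=> s; rewrite opprK.
    by have -> : (fun t => - - h t) = h by apply: funext => s; rewrite opprK.
  have hre : phi r - e < h r by rewrite hr gtrBl.
  have := continuous01_near (cphie _) (Ac _ Ah) hre.
  by apply: filterS => s /ltW; rewrite /= opprK.
- exists (fun s => - h s) => // s; rewrite ler_norml.
  by have := hphi s; have := phih s => /=; lra.
Qed.

End stone.

(** * Functional calculus in a uniformly closed function lattice *)

Section function_lattice.
Variable R : realType.
Local Notation I := (@unit_interval R).
Variable S : supSpace R I.
Local Notation L := (supCarrier S).
Implicit Types (f g : I -> R) (t : I).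

Lemma supCarrierZ (a : R) f : L f -> L (fun t => a * f t).
Proof.
move=> Lf; have := supCarrierL a Lf (supCarrier0 S).
by under [X in L X -> _]eq_fun do rewrite addr0.
Qed.

Lemma supCarrier_abs f : L f -> L (fun t => `|f t|).
Proof.
move=> Lf; have := supCarrierU Lf (supCarrierZ (-1) Lf).
by under [X in L X -> _]eq_fun do rewrite mulN1r maxrN.
Qed.

(** The admissible [phi] are stable under max and min since [f >= 0], and they contain the affine
    functions since [f] times the truncated ratio is [0] joined with the meet of [g] and [f].
    Approximation gives the rest. Where [f] vanishes, the value of the ratio is immaterial. *)
Lemma supCarrier_quotient f g (phi : I -> R) :
  L f -> L g -> (forall t, 0 <= f t) -> continuous01 phi ->
  L (fun t => f t * phi (clip (g t / f t))).
Proof.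
move=> Lf Lg f0 cphi; apply: supCarrier_lim => e e0.
have [M fM] := supCarrier_bounded Lf.
pose A : set (I -> R) :=
  [set psi | continuous01 psi /\ L (fun t => f t * psi (clip (g t / f t)))].
have M0 : 0 <= M by exact: le_trans (fM (clip 0)).
(* The bound [M] may be 0, hence the denominator [M + 1]. *)
have d0 : 0 < e / (M + 1) by rewrite divr_gt0//; lra.
have [||||psi [_ Lpsi] phipsi] := @stone_lattice R A phi (e / (M + 1)) _ _ _ _ cphi d0.
- by move=> h [].
- move=> a b; split; first exact: continuous_affine.
  have := supCarrierL b Lf (supCarrierZ a
    (supCarrierU (supCarrier0 S) (supCarrierI Lg Lf))).
  congr L; apply: funext => t /=.
  have [ft0|ft0] := eqVneq (f t) 0.
    have /max_idPl -> : Num.min (g t) (f t) <= 0 by rewrite ft0 ge_min lexx orbT.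
    by rewrite ft0; ring.
  have ft : 0 < f t by rewrite lt_def ft0 f0.
  have -> : Num.max 0 (Num.min (g t) (f t)) =
      f t * Num.max 0 (Num.min (g t / f t) 1).
    rewrite maxr_pMr// minr_pMr// mulr0 mulr1.
    by rewrite mulrCA divff// mulr1.
  by ring.
- move=> h k [ch Lh] [ck Lk]; split; first exact: continuous01U.
  have := supCarrierU Lh Lk; congr L; apply: funext => t /=.
  by rewrite maxr_pMr.
- move=> h k [ch Lh] [ck Lk]; split; first exact: continuous01I.
  have := supCarrierI Lh Lk; congr L; apply: funext => t /=.
  by rewrite minr_pMr.
- exists (fun t => f t * psi (clip (g t / f t))) => // t.
  rewrite -mulrBr normrM.
  apply: (le_trans (ler_pM _ _ (fM t) (phipsi _))) => //.
  by rewrite mulrCA ger_pMr// ler_pdivrMr ?mul1r; lra.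
Qed.

End function_lattice.

(** * Minima and intermediate values on subintervals *)

Section selection.
Variable R : realType.
Local Notation I := (@unit_interval R).
Implicit Types (f g : I -> R) (t : I).

Lemma continuous_clip_comp f : continuous01 f -> continuous (f \o @clip R).
Proof.
move=> cf x; apply: continuous_comp; [exact: continuous_clip|exact: cf].
Qed.

Lemma continuous01_pos_min f (a b : I) : continuous01 f -> val a <= val b ->
  (forall t, val a <= val t <= val b -> 0 < f t) ->
  exists2 m : R, 0 < m & forall t, val a <= val t <= val b -> m <= f t.
Proof.
move=> cf ab f0.
have [|c cab fc] := EVT_min (f := f \o @clip R) ab.
  by apply: continuous_subspaceT; exact: continuous_clip_comp.
have c01 : 0 <= c <= 1.
  move: cab; rewrite in_itv/=.
  move=> /andP[ac cb]; have /andP[a0 _] := val_unit a.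
  by have /andP[_ b1] := val_unit b; rewrite (le_trans a0 ac) (le_trans cb b1).
exists (f (clip c)); first by apply: f0; rewrite val_clip//; move: cab; rewrite in_itv.
by move=> t tab; rewrite -[t in leRHS]clipK; apply: fc; rewrite in_itv.
Qed.

(** Intermediate value theorem for [g - val x * f], which is at most 0 at [a] and at least 0 at
    [b]. *)
Lemma ratio_onto f g (a b : I) : continuous01 f -> continuous01 g ->
  val a <= val b -> 0 <= f a -> 0 <= f b -> g a = 0 -> g b = f b ->
  forall x : I, exists2 t, val a <= val t <= val b & g t = val x * f t.
Proof.
move=> cf cg ab fa fb ga gb x.
have ch : continuous01 (fun t => (- val x) * f t + g t) by exact: continuous01L.
have [||c cab] := @IVT R ((fun t => (- val x) * f t + g t) \o @clip R) _ _ 0 ab.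
- by apply: continuous_subspaceT; exact: continuous_clip_comp.
- rewrite /= !clipK ga gb ge_min le_max; apply/andP; split; apply/orP.
    by left; have /andP[x0 _] := val_unit x; rewrite addr0 mulNr oppr_le0 mulr_ge0.
  right; rewrite mulNr addrC subr_ge0 ler_piMl//.
  by case/andP: (val_unit x).
- have c01 : 0 <= c <= 1.
    move: cab; rewrite in_itv/=.
    move=> /andP[ac cb]; have /andP[a0 _] := val_unit a.
    by have /andP[_ b1] := val_unit b; rewrite (le_trans a0 ac) (le_trans cb b1).
  move=> /= h0; exists (clip c); first by rewrite val_clip//; move: cab; rewrite in_itv.
  lra.
Qed.

End selection.

(** * Closedness by approximation, and inverses of lattice isomorphisms *)

Lemma closed_distP (R : realType) (E : normedModType R) (A : set E) :
  closed A <->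
  (forall x, (forall e : R, 0 < e -> exists2 y, A y & `|x - y| <= e) -> A x).
Proof.
split=> [cA x xA|xA x clx].
  apply: cA => B /nbhs_ballP [e /= e0 eB].
  have [|y Ay xy] := xA (e / 2); first by rewrite divr_gt0.
  exists y; split=> //; apply: eB; rewrite -ball_normE /=.
  by apply: le_lt_trans xy _; rewrite ltr_pdivrMr// ltr_pMr// ltr1n.
apply: xA => e e0; have [y [Ay]] := clx _ (nbhsx_ballx x e e0).
by rewrite -ball_normE /= => /ltW; exists y.
Qed.

(** Needed because the embedding is built as a map out of C[0,1], whereas the theorem asks for a map
    onto it. *)
Lemma lattice_isomorphic_sym (R : realType) (E F : banachLatticeType R)
    (A : set E) (B : set F) :
  sublattice A -> lattice_isomorphic A B -> lattice_isomorphic B A.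
Proof.
move=> [[A0 AL] AU AI].
move=> [T [[_ TU TI] [[TL [M TM]] [TAB Tinj Tsurj] [N TN]]]].
pose T' y := xget 0 [set x | A x /\ T x = y].
have TK x : A x -> T' (T x) = x.
  move=> Ax; rewrite /T'; case: xgetP => [_ -> [Az Tz]|/(_ x)[]//].
  by apply: Tinj; rewrite ?inE.
have T'op : operator_on B T'.
  split=> [a _ _ /Tsurj[x Ax <-] /Tsurj[y Ay <-]|].
    by rewrite -TL// !TK//; exact: AL.
  by exists N => _ /Tsurj[x Ax <-]; rewrite TK//; exact: TN.
exists T'; split; split=> //.
- by move=> _ _ /Tsurj[x Ax <-] /Tsurj[y Ay <-]; rewrite -TU// !TK//; exact: AU.
- by move=> _ _ /Tsurj[x Ax <-] /Tsurj[y Ay <-]; rewrite -TI// !TK//; exact: AI.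
- split.
  + by move=> _ /Tsurj[x Ax <-]; rewrite TK.
  + move=> y z /set_mem/Tsurj[x Ax <-] /set_mem/Tsurj[w Aw <-].
    by rewrite !TK// => ->.
  + by move=> x Ax; exists (T x); [exact: TAB|exact: TK].
- by exists M => _ /Tsurj[x Ax <-]; rewrite TK//; exact: TM.
Qed.

(** * Embedding C[0,1] into a closed sublattice *)

Section C01_sublattice.
Variable R : realType.
Local Notation I := (@unit_interval R).

Definition ev (x : C01 R) : I -> R := val (x : supFun (C01_supSpace R)).

Lemma ev_continuous (x : C01 R) : continuous01 (ev x).
Proof. exact (@supFunP R I (C01_supSpace R) x). Qed.

Lemma ev_inj : injective ev.
Proof. by move=> x y xy; apply: val_inj. Qed.

Lemma ev_surj (f : I -> R) : continuous01 f -> exists x, ev x = f.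
Proof. by move=> cf; exists (mkSup (cf : supCarrier (C01_supSpace R) f)). Qed.

Lemma ev_normP (x : C01 R) (M : R) :
  0 <= M -> `|x| <= M <-> forall t, `|ev x t| <= M.
Proof. exact: supNorm_leP. Qed.

Lemma ev_norm (x : C01 R) t : `|ev x t| <= `|x|.
Proof. exact: supNorm_ub. Qed.

Lemma evL (a : R) (x y : C01 R) : ev (a *: x + y) = fun t => a * ev x t + ev y t.
Proof. by []. Qed.

Lemma closed_sublattice_supSpace (X : set (C01 R)) : closed_sublattice X ->
  exists S : supSpace R I, supCarrier S = ev @` X.
Proof.
move=> [[[X0 XL] XU XI] /closed_distP Xc].
unshelve eexists (SupSpace (supCarrier := ev @` X) _ _ _ _ _ _) => //.
- by exists 0.
- by move=> a _ _ [x Xx <-] [y Xy <-]; exists (a *: x + y) => //; exact: XL.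
- by move=> _ _ [x Xx <-] [y Xy <-]; exists (bl_join x y) => //; exact: XU.
- by move=> _ _ [x Xx <-] [y Xy <-]; exists (bl_meet x y) => //; exact: XI.
- by move=> _ [x _ <-]; exists `|x| => t; exact: ev_norm.
- move=> f fX; have [|x xf] := @ev_surj f.
    apply: continuous01_lim => e /fX[_ [x _ <-] fx].
    by exists (ev x) => //; exact: ev_continuous.
  exists x => //; apply: Xc => e e0; have [_ [y Xy <-] fy] := fX e e0.
  by exists y => //; apply/ev_normP; [exact: ltW|rewrite -xf in fy].
Qed.

Variables (X : set (C01 R)) (S : supSpace R I).
Hypothesis SX : supCarrier S = ev @` X.

Lemma ev_supCarrier x : supCarrier S (ev x) <-> X x.
Proof.
by rewrite SX; split=> [[y Xy /ev_inj <-]//|Xx]; exists x.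
Qed.

Lemma supCarrier_continuous f : supCarrier S f -> continuous01 f.
Proof. by rewrite SX => -[x _ <-]; exact: ev_continuous. Qed.

(** The map sends [x] to [f] times [x] composed with the truncated ratio [g / f]. At a point
    [sigma r] where the ratio is [r], the image recovers the value of [x] at [r] up to a factor at
    least [m > 0]; this lower bound gives injectivity and closed range. *)
Lemma C01_embedding f g (a b : I) : supCarrier S f -> supCarrier S g ->
  (forall t, 0 <= f t) -> val a <= val b ->
  (forall t, val a <= val t <= val b -> 0 < f t) -> g a = 0 -> g b = f b ->
  exists Y : set (C01 R),
    [/\ Y `<=` X, closed_sublattice Y & lattice_isomorphic Y [set: C01 R]].
Proof.
move=> Lf Lg f0 ab fab ga gb.
have cf := supCarrier_continuous Lf; have cg := supCarrier_continuous Lg.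
have /choice [T TE] (x : C01 R) :
    exists y : C01 R, ev y = fun t => f t * ev x (clip (g t / f t)).
  apply: ev_surj; apply: supCarrier_continuous.
  exact: (supCarrier_quotient Lf Lg f0 (@ev_continuous x)).
have [m m0 fm] := continuous01_pos_min cf ab fab.
have [M fM] := supCarrier_bounded Lf.
have M0 : 0 <= M by exact: le_trans (fM a).
(* A right inverse of the ratio on the interval from [a] to [b]; it need not be continuous. *)
have /choice[sigma sigmaP] (r : I) :
    exists t : I, val a <= val t <= val b /\ g t = val r * f t.
  have [t tab gt] := ratio_onto cf cg ab (f0 _) (f0 _) ga gb r.
  by exists t.
have fsigma r : m <= f (sigma r) by apply: fm; case: (sigmaP r).
have Tsigma x r : ev (T x) (sigma r) = f (sigma r) * ev x r.
  have [_ gs] := sigmaP r; rewrite TE gs mulfK ?clipK//.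
  by rewrite gt_eqF// (lt_le_trans m0).
have TL (c : R) x y : T (c *: x + y) = c *: T x + T y.
  by apply: ev_inj; rewrite TE !evL !TE; apply: funext => t; ring.
have TU x y : T (bl_join x y) = bl_join (T x) (T y).
  apply: ev_inj; apply: funext => t.
  rewrite -[RHS]/(Num.max (ev (T x) t) (ev (T y) t)) !TE.
  by rewrite -maxr_pMr.
have TI x y : T (bl_meet x y) = bl_meet (T x) (T y).
  apply: ev_inj; apply: funext => t.
  rewrite -[RHS]/(Num.min (ev (T x) t) (ev (T y) t)) !TE.
  by rewrite -minr_pMr.
have TM x : `|T x| <= M * `|x|.
  apply/ev_normP => [|t]; first by rewrite mulr_ge0.
  by rewrite TE normrM ler_pM// ev_norm.
have Tm x : `|x| <= m^-1 * `|T x|.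
  apply/ev_normP => [|r]; first by rewrite mulr_ge0// invr_ge0 ltW.
  rewrite ler_pdivlMl//; apply: le_trans (ev_norm (T x) (sigma r)).
  by rewrite Tsigma normrM ler_wpM2r// (le_trans (fsigma r))// ler_norm.
have Tinj : injective T.
  move=> x y Txy; apply/eqP; rewrite -subr_eq0 -normr_le0.
  apply: le_trans (Tm _) _.
  by rewrite -scaleN1r addrC TL Txy scaleN1r addNr normr0 mulr0.
have T0 : T 0 = 0 by apply: ev_inj; rewrite TE; apply: funext => t; exact: mulr0.
exists (range T); split.
- move=> _ [x _ <-]; apply/ev_supCarrier; rewrite TE.
  exact: (supCarrier_quotient Lf Lg f0 (@ev_continuous x)).
- split; first split.
  + split; first by exists 0.
    by move=> c _ _ [x _ <-] [y _ <-]; exists (c *: x + y).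
  + by move=> _ _ [x _ <-] [y _ <-]; exists (bl_join x y).
  + by move=> _ _ [x _ <-] [y _ <-]; exists (bl_meet x y).
  + apply/closed_distP => y yT.
    (* The only possible preimage of the limit [y]. It is continuous as a uniform limit of the
       preimages [z]: dividing by [f >= m] turns an error [e * m] into [e]. *)
    have [x xE] : exists x : C01 R, ev x = fun r => ev y (sigma r) / f (sigma r).
      apply: ev_surj; apply: continuous01_lim => e e0.
      have [|_ [z _ <-] yz] := yT (e * m); first by rewrite mulr_gt0.
      exists (ev z) => [|r]; first exact: ev_continuous.
      have fr : 0 < f (sigma r) by exact: lt_le_trans (fsigma r).
      have -> : ev y (sigma r) / f (sigma r) - ev z r =
          (ev y (sigma r) - ev (T z) (sigma r)) / f (sigma r).
        by rewrite Tsigma; field; rewrite gt_eqF.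
      rewrite normrM normfV (gtr0_norm fr) ler_pdivrMr//.
      apply: (le_trans (ev_norm (y - T z) (sigma r))).
      by apply: (le_trans yz); rewrite ler_pM2l.
    exists x => //; apply/eqP; rewrite -subr_eq0 -normr_le0.
    apply/ler_addgt0Pr => e e0; rewrite add0r.
    have k0 : 0 < 1 + M * m^-1.
      by rewrite ltr_pwDl// mulr_ge0// invr_ge0 ltW.
    (* Since [T x - y] is [T (x - z) - (y - T z)], its norm is at most [M / m + 1] times that of
       [y - T z]. *)
    have [|_ [z _ <-] yz] := yT (e / (1 + M * m^-1)); first by rewrite divr_gt0.
    have xz : `|x - z| <= m^-1 * `|y - T z|.
      apply/ev_normP => [|r]; first by rewrite mulr_ge0// invr_ge0 ltW.
      have fr : 0 < f (sigma r) by exact: lt_le_trans (fsigma r).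
      have -> : ev (x - z) r =
          (ev y (sigma r) - ev (T z) (sigma r)) / f (sigma r).
        rewrite -[LHS]/(ev x r - ev z r) xE Tsigma; field; by rewrite gt_eqF.
      rewrite normrM normfV (gtr0_norm fr) mulrC.
      apply: ler_pM => //; last exact: (ev_norm (y - T z) (sigma r)).
        by rewrite invr_ge0 ltW.
      by rewrite lef_pV2.
    have -> : T x - y = T (x - z) - (y - T z).
      rewrite [x - z]addrC -[- z]scaleN1r TL scaleN1r opprB [- T z + _]addrC.
      by rewrite addrA subrK.
    apply: le_trans (ler_normB _ _) _.
    apply: (@le_trans _ _ ((1 + M * m^-1) * `|y - T z|)).
      rewrite mulrDl mul1r addrC lerD2l -mulrA.
      by apply: le_trans (TM _) _; rewrite ler_wpM2l.
    by rewrite mulrC -ler_pdivlMr.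
- apply: lattice_isomorphic_sym; first by split.
  have Top : operator_on setT T.
    by split=> [c x y _ _|]; [exact: TL|exists M => x _; exact: TM].
  exists T; split; split=> //; last by exists m^-1.
  by split=> [x _|x y _ _|y [x _ <-]]; [exists x|exact: Tinj|exists x].
Qed.

End C01_sublattice.

(** * Points with proportional evaluations, and atoms *)

Section proportional_points.
Variable R : realType.
Local Notation I := (@unit_interval R).
Variable S : supSpace R I.
Local Notation L := (supCarrier S).
Implicit Types (f g : I -> R) (r s t : I).

Definition alive t := exists2 f, L f & f t != 0.

(** Cross-multiplication avoids naming the ratio of the two evaluations. A point where all of [L]
    vanishes would satisfy the identity with every other point and break transitivity, hence the two
    [alive] clauses. *)
Definition proportional s t := [/\ alive s, alive t &
  forall f g, L f -> L g -> f s * g t = f t * g s].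

Lemma alive_pos t : alive t ->
  exists f, [/\ L f, forall s, 0 <= f s & f t = 1].
Proof.
move=> [f Lf ft]; exists (fun s => `|f t|^-1 * `|f s|); split.
- exact/supCarrierZ/supCarrier_abs.
- by move=> s; rewrite mulr_ge0.
- by rewrite mulVf// normr_eq0.
Qed.

Lemma notin_alive t f : L f -> ~ alive t -> f t = 0.
Proof. by move=> Lf nt; apply: contrapT => /eqP ft; apply: nt; exists f. Qed.

Lemma proportional_refl t : alive t -> proportional t t.
Proof. by move=> at_; split=> // f g _ _. Qed.

Lemma proportional_sym s t : proportional s t -> proportional t s.
Proof. by move=> [as_ at_ st]; split=> // f g Lf Lg; rewrite -st. Qed.

Lemma proportional_trans t s r :
  proportional s t -> proportional t r -> proportional s r.
Proof.
move=> [as_ [k Lk kt] st] [_ ar tr]; split=> // f g Lf Lg.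
apply: (mulfI kt).
have -> : k t * (f s * g r) = (f s * k t) * g r by ring.
have -> : k t * (f r * g s) = f r * (g s * k t) by ring.
rewrite (st f k)// (st g k)//.
have -> : f t * k s * g r = k s * (f t * g r) by ring.
by rewrite (tr f g)//; ring.
Qed.

(** If [f] and [g] witness the failure of proportionality, the combination [g s * f - f s * g]
    vanishes at [s] but not at [t]; it remains to normalize and take absolute values. If [s] is not
    alive, any positive function normalized at [t] will do. *)
Lemma separation s t : alive t -> ~ proportional t s ->
  exists h, [/\ L h, forall r, 0 <= h r, h t = 1 & h s = 0].
Proof.
move=> at_ nts; have [as_|nas] := pselect (alive s); last first.
  have [f [Lf f0 ft]] := alive_pos at_; exists f; split=> //.
  exact: notin_alive.
have [f [g [Lf Lg fg]]] : exists f g, [/\ L f, L g & f t * g s != f s * g t].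
  apply: contrapT => nfg; apply: nts; split=> // f g Lf Lg.
  by apply: contrapT => /eqP fg; apply: nfg; exists f, g.
have d0 : g s * f t - f s * g t != 0 by rewrite mulrC subr_eq0.
pose h r := g s * f r + (- f s * g r + 0).
exists (fun r => `|(g s * f t - f s * g t)^-1 * h r|); split=> //.
- apply/supCarrier_abs/supCarrierZ/supCarrierL => //.
  by apply: supCarrierL => //; exact: supCarrier0.
- by rewrite /h addr0 mulNr mulVf// normr1.
- by rewrite (_ : h s = 0) ?mulr0 ?normr0// /h; ring.
Qed.

(** An atom in the vector lattice sense: by [atomE], a member of [L] vanishing off the class of [t]
    is a multiple of [e]. *)
Definition atom t e :=
  [/\ L e, e t = 1, forall s, 0 <= e s & forall s, ~ proportional t s -> e s = 0].

Lemma atomE f t e s : L f -> alive t -> atom t e -> proportional t s ->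
  f s = f t * e s.
Proof. by move=> Lf at_ [Le et _ _] [_ _ /(_ f e Lf Le) ->]; rewrite et mulr1. Qed.

(** The alternative to embedding C[0,1]: a failure yields, after a linear change of [g], the data
    for [C01_embedding]. *)
Definition locally_proportional := forall f g a b,
  L f -> L g -> (forall t, 0 <= f t) -> val a <= val b ->
  (forall t, val a <= val t <= val b -> 0 < f t) -> f a * g b = f b * g a.

End proportional_points.

(** * Open classes, their atoms and their representatives *)

Section proportional_classes.
Variable R : realType.
Local Notation I := (@unit_interval R).
Variable S : supSpace R I.
Local Notation L := (supCarrier S).
Implicit Types (f g : I -> R) (r s t : I).

Hypothesis Lc : L `<=` @continuous01 R.
Hypothesis Lprop : locally_proportional S.

Local Notation alive := (alive S).
Local Notation proportional := (proportional S).
Local Notation atom := (atom S).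

(** Near [t], the segment from [t] to [s] stays where a fixed [f] is positive, so every member of
    [L] is compared with this same [f]; cancelling [f t] compares any two members. *)
Lemma near_proportional t : alive t -> \forall s \near t, proportional t s.
Proof.
move=> at_; have [f [Lf f0 ft]] := alive_pos at_.
have ft0 : 0 < f t by rewrite ft.
have c0 : continuous01 (fun=> 0 : R) by move=> ?; exact: cvg_cst.
have /near_unitP[e e0 fe] := continuous01_near c0 (Lc Lf) ft0.
apply/near_unitP; exists e => // s ts.
have fs := fe s ts.
have key g : L g -> f t * g s = f s * g t.
  move=> Lg; have [le_ts|/ltW le_st] := leP (val t) (val s).
    apply: Lprop => // r /andP[tr rs]; apply: fe.
    move: ts; rewrite !ler0_norm ?subr_le0// !opprB; lra.
  apply/esym/Lprop => // r /andP[tr rs]; apply: fe.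
  move: ts; rewrite !ger0_norm ?subr_ge0//; lra.
split=> //; first by exists f => //; rewrite gt_eqF.
have ft1 : f t != 0 by rewrite gt_eqF.
move=> g h Lg Lh; apply: (mulfI ft1).
have -> : f t * (g t * h s) = g t * (f t * h s) by ring.
have -> : f t * (g s * h t) = (f t * g s) * h t by ring.
by rewrite !key//; ring.
Qed.

Lemma near_alive0 t f e : L f -> ~ alive t -> 0 < e ->
  \forall s \near t, `|f s| < e.
Proof.
move=> Lf nt e0; apply: continuous01_near.
- by apply: Lc; exact: supCarrier_abs.
- by move=> s; exact: cvg_cst.
- by rewrite (notin_alive Lf nt) normr0.
Qed.

(** The truncation of [f] to the class of [t] is a uniform limit of members of [L]: compactness
    gives a positive [h] with value 1 at [t] and at most [e] off the class, and on the class [h]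
    equals [f] because both are 1 at [t]. *)
Lemma atom_exists t : alive t -> exists e, atom t e.
Proof.
move=> at_; have [f [Lf f0 ft]] := alive_pos at_.
pose F s := if `[< proportional t s >] then f s else 0.
exists F; split; last 3 first.
- by rewrite /F ifT//; apply/asboolP; exact: proportional_refl.
- by move=> s; rewrite /F; case: ifP.
- by move=> s /asboolPn/negbTE nts; rewrite /F nts.
apply: supCarrier_lim => e e0.
have [||||h [Lh ht h0] hB] := @near_meet R
    [set h | [/\ L h, h t = 1 & forall s, 0 <= h s]]
    (fun s => [set x | proportional t s \/ x <= e]).
- by exists f.
- move=> g h [Lg gt g0] [Lh ht h0]; split; first exact: supCarrierI.
    by rewrite gt ht minxx.
  by move=> s; rewrite le_min g0 h0.
- by move=> s x y xy /= [|ye]; [left|right; exact: le_trans ye].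
- move=> s; have [ts|nts] := pselect (proportional t s).
    exists f => //; have [_ as_ _] := ts.
    apply: filterS (near_proportional as_) => r sr; left.
    exact: proportional_trans ts sr.
  have [as_|nas] := pselect (alive s); last first.
    exists f => //; apply: filterS (near_alive0 Lf nas e0) => r /ltW fr; right.
    exact: le_trans (ler_norm _) fr.
  (* This [h] vanishes at [s], hence on the whole class of [s], which is a neighbourhood of [s]. *)
  have [h [Lh h0 ht hs]] := separation at_ nts; exists h => //.
  apply: filterS (near_proportional as_) => r [[k Lk ks] _ sr]; right.
  have := sr h k Lh Lk; rewrite hs mul0r => /esym/eqP.
  rewrite mulrC mulf_eq0 (negbTE ks)/= => /eqP ->; exact: ltW.
- exists h => // s; rewrite /F; case: ifPn => [/asboolP ts|/asboolPn nts].
    have [_ _ /(_ f h Lf Lh)] := ts.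
    by rewrite ft ht mul1r mulr1 => ->; rewrite subrr normr0 ltW.
  by rewrite sub0r normrN ger0_norm//; case: (hB s).
Qed.

(** The points where the atom of the class attains its maximum; normalized there, it has norm 1,
    which later makes evaluation at such points isometric. *)
Definition peak t : set I :=
  [set m | proportional t m /\
     exists2 e, atom m e & forall s, e s <= 1].

Lemma peak_exists t : alive t -> exists m, peak t m.
Proof.
move=> at_; have [e [Le et e0 eN]] := atom_exists at_.
have [|m _ em] := @compact_EVT_max I R e setT (ex_intro _ t Logic.I) (@compact_unit R).
  by apply: continuous_subspaceT => s; exact: (Lc Le).
have em1 : 1 <= e m by rewrite -et em// inE.
have em0 : 0 < e m by exact: lt_le_trans em1.
have tm : proportional t m.
  by apply: contrapT => /eN em_; move: em0; rewrite em_ ltxx.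
exists m; split=> //; exists (fun s => (e m)^-1 * e s); first split.
- exact: supCarrierZ.
- by rewrite mulVf// gt_eqF.
- by move=> s; rewrite mulr_ge0// invr_ge0 ltW.
- move=> s nms; rewrite (eN s) ?mulr0// => ts; apply: nms.
  exact: proportional_trans (proportional_sym tm) ts.
- by move=> s; rewrite ler_pdivrMl// mulr1 em// inE.
Qed.

(** The choice is made from a set depending only on the class, so proportional points share one
    representative. For a point that is not alive this set is empty and the default [clip 0] is
    returned. *)
Definition rep t : I := xget (clip 0) (peak t).

Lemma rep_peak t : alive t -> peak t (rep t).
Proof. by move=> /peak_exists[m tm]; exact: (xgetPex _ (ex_intro _ m tm)). Qed.

Lemma proportional_rep t : alive t -> proportional t (rep t).
Proof. by move=> /rep_peak[]. Qed.

Lemma rep_proportional s t : proportional s t -> rep s = rep t.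
Proof.
move=> st; congr (xget _ _); apply/seteqP; split=> m [Em em]; split=> //.
  exact: proportional_trans (proportional_sym st) Em.
exact: proportional_trans st Em.
Qed.

Definition reps : set I := rep @` alive.

Lemma reps_alive d : reps d -> alive d.
Proof. by move=> [t /proportional_rep[_ ? _] <-]. Qed.

Lemma reps_rep d : reps d -> rep d = d.
Proof.
by move=> [t at_ <-]; apply/esym/rep_proportional/proportional_rep.
Qed.

Lemma rep_reps t : alive t -> reps (rep t).
Proof. by exists t. Qed.

Lemma rep_atoms : exists A : I -> I -> R, forall d, reps d ->
  atom d (A d) /\ forall s, A d s <= 1.
Proof.
suff /choice[A AP] : forall d, exists e : I -> R,
  reps d -> atom d e /\ forall s, e s <= 1 by exists A.
move=> d; have [[t /rep_peak[_ [e de e1]] <-]|nd] := pselect (reps d).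
  by exists e.
by exists (fun=> 0).
Qed.

(** Each class is open, so it contains the [clip] of some rational, from which [rep] recovers the
    representative. The rational may fall outside [0,1], but [clip] does not increase distances. *)
Lemma countable_reps : countable reps.
Proof.
pose r (q : rat) := rep (clip (ratr q : R)).
apply: (@sub_countable _ _ _ (range r)); last first.
  apply: (card_le_trans (card_image_le _ _)); exact: countableP.
apply: subset_card_le => d dD.
have /near_unitP[e e0 de] := near_proportional (reps_alive dD).
have [_ [/[swap] -[q _ <-] dq]] := @dense_rat R (ball (val d) e)
  (ex_intro _ (val d) (ballxx _ e0)) (ball_open (val d) e).
exists q => //; rewrite /r -[RHS]reps_rep//; apply/esym/rep_proportional/de.
rewrite -{1}(clipK d); exact: le_lt_trans (clip_dist _ _) dq.
Qed.

(** Locally the set has at most one element: near an alive point there is only one class, and near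
    any other point [f] is smaller than [e]. *)
Lemma finite_large_reps f (e : R) : L f -> 0 < e ->
  finite_set [set d | reps d /\ e <= `|f d|].
Proof.
move=> Lf e0; pose P (N : set I) := finite_set [set d | [/\ reps d, N d & e <= `|f d|]].
suff : P setT by apply: sub_finite_set => d [].
apply: (compact_ind (@compact_unit R)).
- by apply: (@sub_finite_set _ _ set0) => // d [].
- by move=> A B AB; apply: sub_finite_set => d [Dd /AB].
- move=> A B PA PB; have : finite_set ([set d | [/\ reps d, A d & e <= `|f d|]] `|`
      [set d | [/\ reps d, B d & e <= `|f d|]]) by rewrite finite_setU.
  by apply: sub_finite_set => d [Dd [Ad|Bd] ed]; [left|right].
- move=> s _; have [as_|nas] := pselect (alive s).
    exists [set t | proportional s t]; first exact: near_proportional.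
    apply: (@sub_finite_set _ _ [set rep s]) => // d [Dd sd _].
    by rewrite /= (rep_proportional sd) reps_rep.
  exists [set t | `|f t| < e]; first exact: near_alive0.
  by apply: (@sub_finite_set _ _ set0) => // d [_ /= fe]; rewrite leNgt fe.
Qed.

(** This puts the sequence of values at the representatives in c_0. *)
Lemma near_reps (idx : I -> nat) (pt : nat -> I) f (e : R) :
  (forall n, reps (pt n) /\ idx (pt n) = n) -> L f -> 0 < e ->
  \forall n \near \oo, `|f (pt n)| <= e.
Proof.
move=> ptP Lf e0.
have /finite_seqP[s sE] := finite_image idx (finite_large_reps Lf e0).
exists (\max_(i <- s) i).+1 => // n /= ns; rewrite leNgt; apply/negP => fn.
have : (idx @` [set d | reps d /\ e <= `|f d|]) n.
  by have [Dn ni] := ptP n; exists (pt n) => //; split=> //; exact: ltW.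
rewrite sE /= => ns'; have := @leq_bigmax_seq _ s xpredT id n ns' isT.
by rewrite leqNgt ns.
Qed.

End proportional_classes.

(** * Coordinates along the atoms and the identification with c_0 *)

Section atomic_sublattice.
Variable R : realType.
Local Notation I := (@unit_interval R).
Variables (X : set (C01 R)) (S : supSpace R I).
Hypothesis SX : supCarrier S = @ev R @` X.
Hypothesis Sprop : locally_proportional S.
Implicit Types (s t : I).

Let Sc := supCarrier_continuous SX.

(** At any point, only the atom of its own class can be nonzero, so each [x] is the sum of the atoms
    weighted by its values at their representatives. *)
Lemma finite_reps_dim : finite_set (reps S) -> finite_dimensional X.
Proof.
move=> [n /card_set_bijP[idx [idxn idxinj idxsurj]]].
have [A AP] := rep_atoms Sc Sprop.
have /choice[pt ptP] (i : 'I_n) : exists t, reps S t /\ idx t = i.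
  by have [t Dt ti] := idxsurj i (ltn_ord i); exists t.
have /choice[e eP] (i : 'I_n) : exists x, X x /\ ev x = A (pt i).
  have [[LA _ _ _] _] := AP _ (ptP i).1.
  by move: LA; rewrite SX => -[x Xx xA]; exists x.
exists n, e; split=> [i|x Xx]; first by case: (eP i).
exists (fun i => ev x (pt i)); apply: ev_inj; apply: funext => t.
have Lx : supCarrier S (ev x) by apply/(ev_supCarrier SX).
have -> : ev (\sum_i ev x (pt i) *: e i) t = \sum_i ev x (pt i) * A (pt i) t.
  rewrite (big_morph (fun y => ev y t) (id1 := 0) (op1 := +%R))//.
  by apply: eq_bigr => i _; rewrite -(eP i).2.
have [at_|nat_] := pselect (alive S t); last first.
  rewrite (notin_alive Lx nat_) big1// => i _.
  have [[LA _ _ _] _] := AP _ (ptP i).1.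
  by rewrite (notin_alive LA nat_) mulr0.
have Drt := rep_reps at_.
have [[LA Art A0 AN] _] := AP _ Drt.
pose i0 := Ordinal (idxn _ Drt).
have pti0 : pt i0 = rep S t.
  by apply: idxinj; rewrite ?inE//; [case: (ptP i0)|case: (ptP i0)].
rewrite (bigD1 i0)//= big1 ?addr0 => [|i ii0].
  rewrite pti0; apply: atomE Lx (reps_alive Sc Sprop Drt) _ _.
    by case: (AP _ Drt).
  exact/proportional_sym/(proportional_rep Sc Sprop).
have [[_ _ _ AiN] _] := AP _ (ptP i).1.
rewrite AiN ?mulr0// => ptit; move/eqP: ii0; apply; apply: val_inj => /=.
by rewrite -(rep_proportional ptit) (reps_rep Sc Sprop) ?(ptP i).2//; case: (ptP i).
Qed.

(** The isomorphism evaluates at the enumerated representatives. It is isometric because, on each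
    class, [x] is its value at the representative times an atom bounded by 1. *)
Lemma infinite_reps_c0 : sublattice X -> infinite_set (reps S) ->
  lattice_isomorphic X [set: c0 R].
Proof.
move=> [[X0 XL] XU XI] Dinf.
have [idx [_ idxinj idxsurj]] :=
  card_set_bijP (eq_card_nat (countable_reps Sc Sprop) Dinf).
have [A AP] := rep_atoms Sc Sprop.
have /choice[pt ptP] (n : nat) : exists t, reps S t /\ idx t = n.
  by have [t Dt ti] := idxsurj n Logic.I; exists t.
have ptK d : reps S d -> pt (idx d) = d.
  by move=> Dd; apply: idxinj; rewrite ?inE//; case: (ptP (idx d)).
have evE x t : X x -> alive S t -> ev x t = ev x (rep S t) * A (rep S t) t.
  move=> Xx at_; have Drt := rep_reps at_.
  apply: (atomE (S := S)); first exact/(ev_supCarrier SX).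
  - exact: reps_alive Drt.
  - by case: (AP _ Drt).
  - exact/proportional_sym/(proportional_rep Sc Sprop).
have ev0 x t : X x -> ~ alive S t -> ev x t = 0.
  by move=> Xx; apply: notin_alive; apply/(ev_supCarrier SX).
pose evc (u : c0 R) : nat -> R := val (u : supFun (c0_supSpace R)).
have evc_inj : injective evc by move=> u v uv; apply: val_inj.
have /choice[T TE] (x : C01 R) : exists u : c0 R, X x -> evc u = fun n => ev x (pt n).
  have [Xx|nXx] := pselect (X x); last by exists 0.
  suff ux : supCarrier (c0_supSpace R) (fun n => ev x (pt n)) by exists (mkSup ux).
  apply/null_seqP => e e0; apply: (near_reps Sc Sprop ptP) => //.
  exact/(ev_supCarrier SX).
have evc_norm u n : `|evc u n| <= `|u| by exact: supNorm_ub.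
have evc_normP u (M : R) : 0 <= M -> (forall n, `|evc u n| <= M) -> `|u| <= M.
  by move=> M0 uM; apply/supNorm_leP.
have TL (a : R) x y : X x -> X y -> T (a *: x + y) = a *: T x + T y.
  move=> Xx Xy; apply: evc_inj; rewrite TE; last exact: XL.
  by rewrite -[RHS]/(fun n => a * evc (T x) n + evc (T y) n) !TE.
have TU x y : X x -> X y -> T (bl_join x y) = bl_join (T x) (T y).
  move=> Xx Xy; apply: evc_inj; rewrite TE; last exact: XU.
  by rewrite -[RHS]/(fun n => Num.max (evc (T x) n) (evc (T y) n)) !TE.
have TI x y : X x -> X y -> T (bl_meet x y) = bl_meet (T x) (T y).
  move=> Xx Xy; apply: evc_inj; rewrite TE; last exact: XI.
  by rewrite -[RHS]/(fun n => Num.min (evc (T x) n) (evc (T y) n)) !TE.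
have Top : operator_on X T.
  split; first exact: TL.
  exists 1 => x Xx; rewrite mul1r; apply: evc_normP => // n.
  by rewrite TE//; exact: ev_norm.
have Tpt x t : X x -> alive S t ->
    ev x t = evc (T x) (idx (rep S t)) * A (rep S t) t.
  by move=> Xx at_; rewrite TE// ptK; [exact: evE|exact: rep_reps].
have Ale1 t : alive S t -> `|A (rep S t) t| <= 1.
  by move=> /rep_reps/AP[[_ _ A0 _] A1]; rewrite ger0_norm.
exists T; split; split=> //; last first.
  exists 1 => x Xx; rewrite mul1r; apply/ev_normP => // t.
  have [at_|nat_] := pselect (alive S t); last by rewrite ev0// normr0.
  rewrite Tpt// normrM (le_trans _ (evc_norm (T x) (idx (rep S t))))//.
  by rewrite ler_piMr// Ale1.
split=> // [x y /set_mem Xx /set_mem Xy Txy|u _].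
  apply: ev_inj; apply: funext => t.
  have [at_|nat_] := pselect (alive S t); last by rewrite !ev0.
  by rewrite !Tpt// Txy.
(* Surjectivity: [F N] is the sum of the first [N] atoms weighted by [u], and [G] below is the full
   sum. The atoms are disjoint and bounded by 1, so the error is controlled by the largest tail term
   of [u], not by a sum. *)
pose F N t := if `[< alive S t >] && (idx (rep S t) < N)%N
  then evc u (idx (rep S t)) * A (rep S t) t else 0.
have LF N : supCarrier S (F N).
  elim: N => [|N LN].
    have := supCarrier0 S; congr supCarrier; apply: funext => t.
    by rewrite /F ltn0 andbF.
  have [DN idxN] := ptP N; have [[LA _ _ AN] _] := AP _ DN.
  have := supCarrierL (evc u N) LA LN; congr supCarrier; apply: funext => t.
  rewrite /F; case: asboolP => [at_|nat_] /=; last first.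
    by rewrite (notin_alive LA nat_) mulr0 addr0.
  rewrite [in RHS]ltnS [in RHS]leq_eqVlt; case: eqVneq => [rN|rN] /=.
    by rewrite rN ltnn addr0 -rN ptK//; exact: rep_reps.
  rewrite AN ?mulr0 ?add0r// => /rep_proportional ptt.
  by move/eqP: rN; rewrite -ptt (reps_rep Sc Sprop DN) idxN.
pose G t := if `[< alive S t >] then evc u (idx (rep S t)) * A (rep S t) t else 0.
have LG : supCarrier S G.
  apply: supCarrier_lim => e e0.
  have /null_seqP/(_ e e0)[N _ uN] : null_seq (evc u) by exact: (supFunP (u : supFun (c0_supSpace R))).
  exists (F N) => // t; rewrite /G /F; case: asboolP => [at_|nat_] /=; last first.
    by rewrite subrr normr0 ltW.
  case: ltnP => [_|Nr]; first by rewrite subrr normr0 ltW.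
  rewrite subr0 normrM; apply: le_trans (uN _ Nr).
  by rewrite ler_piMr// Ale1.
move: (LG); rewrite SX => -[x Xx xG]; exists x => //.
apply: evc_inj; rewrite TE// xG; apply: funext => n.
have [Dn idxn] := ptP n; have [[_ Ann _ _] _] := AP _ Dn.
rewrite /G asboolT; last exact: reps_alive Dn.
by rewrite (reps_rep Sc Sprop Dn) idxn Ann mulr1.
Qed.

End atomic_sublattice.

(** * The dichotomy *)

Theorem theoremC (R : realType) (X : set (C01 R)) :
  closed_sublattice X -> infinite_dimensional X ->
  lattice_isomorphic X [set: c0 R] \/
  exists Y : set (C01 R),
    [/\ Y `<=` X, closed_sublattice Y & lattice_isomorphic Y [set: C01 R]].
Proof.
move=> Xcs Xinf; have [S SX] := closed_sublattice_supSpace Xcs.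
have [Sprop|] := pselect (locally_proportional S).
  left; apply: (infinite_reps_c0 SX Sprop); first by case: Xcs.
  by move=> /(finite_reps_dim SX Sprop).
move=> nprop; right; apply: contrapT => nY; apply: nprop => f g a b Lf Lg f0 ab fab.
apply: contrapT => /eqP fg; apply: nY.
have fb : 0 < f b by apply: fab; rewrite ab lexx.
have d0 : f a * g b - f b * g a != 0 by rewrite subr_eq0.
(* The combination [f a * g - g a * f] vanishes at [a] and is nonzero at [b]; the scalar makes its
   value at [b] equal to [f b]. *)
pose h t := f b / (f a * g b - f b * g a) * (f a * g t + (- g a * f t + 0)).
apply: (C01_embedding SX (f := f) (g := h) (a := a) (b := b)) => //.
- apply: supCarrierZ; apply: supCarrierL => //.
  by apply: supCarrierL => //; exact: supCarrier0.
- by rewrite /h; field.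
- by rewrite /h; field.
Qed.
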